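(* Let $\mathrm{HA}(3)$ be the hive algebra for $\mathrm{GL}(3)$ (defined in the context with $n=3$). (1) $\mathrm{HA}(3)$ is isomorphic, as a $\mathbb{C}$-algebra, to the quotient of the polynomial algebra in ten indeterminates $x_1,\ldots,x_{10}$ by the ideal generated by $x_1x_6x_7-x_5x_{10}$: \[ \mathrm{HA}(3)\cong\mathbb{C}[x_1,\ldots,x_{10}]/\langle x_1x_6x_7-x_5x_{10}\rangle . \] (2) The Hilbert-Poincaré series $\mathfrak{HP}_3(t)$ of $\mathrm{HA}(3)$ is \[ \mathfrak{HP}_3(t)=\frac{1-t^6}{(1-t)^2(1-t^2)^3(1-t^3)^4(1-t^4)}=1+2t+6t^2+14t^3+29t^4+56t^5+105t^6+182t^7+308t^8+502t^9+\cdots . \]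
   Context: Let $n\ge 1$. A sequence $\kappa=(\kappa_1,\ldots,\kappa_n)\in\mathbb{Z}^n$ is non-negative dominant if $\kappa_1\ge\kappa_2\ge\cdots\ge\kappa_n\ge 0$; write $|\kappa|=\kappa_1+\cdots+\kappa_n$. A triangular array is an array of integers $h=(h_{ij})_{1\le j\le i\le n+1}$. Its boundary is the triple $(\underline{a}_h,\underline{b}_h,\underline{c}_h)$ of sequences in $\mathbb{Z}^n$ with $i$-th entries (for $1\le i\le n$) $a_i=h_{i+1,i+1}-h_{i,i}$, $b_i=h_{i+1,1}-h_{i,1}$, $c_i=h_{n+1,i+1}-h_{n+1,i}$. The rhombus conditions are: (i) $h_{i,j}+h_{i+1,j+1}\ge h_{i+1,j}+h_{i,j+1}$ for $1\le j<i\le n$; (ii) $h_{i,j}+h_{i,j+1}\ge h_{i+1,j+1}+h_{i-1,j}$ for $1\le j<i\le n$; (iii) $h_{i+1,j}+h_{i,j}\ge h_{i+1,j+1}+h_{i,j-1}$ for $1<j\le i\le n$. A hive for $\mathrm{GL}(n)$ is a triangular array of integers with $h_{11}=0$, satisfying all the rhombus conditions, and such that the three sequences $\underline{a}_h,\underline{b}_h,\underline{c}_h$ of its boundary are non-negative dominant. The set $\mathcal{H}(n)$ of all hives for $\mathrm{GL}(n)$ is a submonoid of $\mathbb{Z}^{(n+1)(n+2)/2}$ under entrywise addition. The hive algebra $\mathrm{HA}(n)$ is the $\mathbb{C}$-subalgebra of the polynomial algebra $\mathbb{C}[z_{ij}:1\le j\le i\le n+1]$ generated by the monomials $\mathbf{z}^h=\prod_{i,j}z_{ij}^{h_{ij}}$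 for all $h\in\mathcal{H}(n)$. It is $\mathbb{Z}_{\ge0}$-graded by the degree in $z_{n+1,n+1}$: $\mathbf{z}^h$ has degree $h_{n+1,n+1}$, which equals $|\lambda|=|\mu|+|\nu|$ if $h$ has boundary $(\lambda,\mu,\nu)$. Its Hilbert-Poincaré series is $\mathfrak{HP}_n(t)=\sum_{d\ge0}m_dt^d$, where $m_d$ is the dimension of the degree $d$ homogeneous component of $\mathrm{HA}(n)$. *)

(* Defs.v *)
From HB Require Import structures.
From mathcomp Require Import all_boot all_order all_algebra.
From mathcomp Require Export boolp classical_sets reals.
From mathcomp Require Export generic_quotient ring_quotient complex mpoly.
From mathcomp Require Import zify.

Set Implicit Arguments.
Unset Strict Implicit.
Unset Printing Implicit Defensive.

Import Order.TTheory GRing.Theory Num.Theory.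
Local Open Scope classical_set_scope.
Local Open Scope ring_scope.

Section GeneratedSubalgebra.
Variables (K : fieldType) (A : comAlgType K) (G : set A).

Definition alg_gen : {pred A} := fun a =>
  `[< forall S : {pred A}, subalg_closed S -> (forall g, G g -> g \in S) ->
      a \in S >].

Lemma alg_genP a :
  reflect (forall S : {pred A}, subalg_closed S ->
             (forall g, G g -> g \in S) -> a \in S)
          (a \in alg_gen).
Proof. exact: asboolP. Qed.

Lemma mem_alg_gen g : G g -> g \in alg_gen.
Proof. by move=> Gg; apply/alg_genP => S _; apply. Qed.

Lemma alg_gen_closed : subalg_closed alg_gen.
Proof.
split.
- by apply/alg_genP => S [].
- move=> k x y /alg_genP xS /alg_genP yS; apply/alg_genP => S cS GS.
  by case: (cS) => _ + _; apply; [apply: xS|apply: yS].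
- move=> x y /alg_genP xS /alg_genP yS; apply/alg_genP => S cS GS.
  by case: (cS) => _ _; apply; [apply: xS|apply: yS].
Qed.

HB.instance Definition _ :=
  GRing.isSubalgClosed.Build K A alg_gen (GRing.subalg_closed_semi alg_gen_closed).

Record gen_subalg := GenSubalg {
  gen_subalg_val :> A;
  gen_subalgP : gen_subalg_val \in alg_gen }.

HB.instance Definition _ := [isSub for gen_subalg_val].
HB.instance Definition _ := [Choice of gen_subalg by <:].
HB.instance Definition _ := [SubChoice_isSubAlgebra of gen_subalg by <:].
HB.instance Definition _ := [SubNzRing_isSubComNzRing of gen_subalg by <:].

End GeneratedSubalgebra.

Definition is_ideal (A : comNzRingType) (I : set A) :=
  [/\ I 0, forall x y, I x -> I y -> I (x + y) & forall a x, I x -> I (a * x)].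

Definition ideal_gen (A : comNzRingType) (g : A) : {pred A} := fun a =>
  `[< forall I : set A, is_ideal I -> I g -> I a >].

Lemma ideal_genP (A : comNzRingType) (g a : A) :
  reflect (exists q, a = q * g) (a \in ideal_gen g).
Proof.
apply: (iffP (asboolP _)) => [|[q ->] I [_ _ IM] Ig]; last exact: IM.
move/(_ [set x | exists q, x = q * g]); apply; last by exists 1; rewrite mul1r.
split; first by exists 0; rewrite mul0r.
- by move=> x y [q ->] [r ->]; exists (q + r); rewrite mulrDl.
- by move=> b x [q ->]; exists (b * q); rewrite mulrA.
Qed.

Lemma ideal_gen_closed (A : comNzRingType) (g : A) :
  1 \notin ideal_gen g -> idealr_closed (ideal_gen g).
Proof.
move=> g1; split=> //; first by apply/ideal_genP; exists 0; rewrite mul0r.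
move=> a x y /ideal_genP[q ->] /ideal_genP[r ->]; apply/ideal_genP.
by exists (a * q + r); rewrite mulrDl mulrA.
Qed.

(* The library only gives [{ideal_quot I}] a ring structure; the scalars act
   on it through [k |-> k%:A]. *)
Section QuotientAlgebra.
Local Open Scope quotient_scope.
Variables (K : fieldType) (A : comAlgType K) (I : idealr A).
Local Notation Q := {ideal_quot I}.

Definition quot_scale (k : K) (x : Q) : Q := \pi_Q (k%:A) * x.

Lemma quot_scaleA a b v : quot_scale a (quot_scale b v) = quot_scale (a * b) v.
Proof.
by rewrite /quot_scale mulrA -rmorphM /= -scalerAl mul1r scalerA.
Qed.

Lemma quot_scale1 : left_id 1 quot_scale.
Proof. by move=> x; rewrite /quot_scale scale1r rmorph1 mul1r. Qed.

Lemma quot_scaleDr : right_distributive quot_scale +%R.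
Proof. by move=> k x y; rewrite /quot_scale mulrDr. Qed.

Lemma quot_scaleDl v : {morph quot_scale^~ v : a b / a + b}.
Proof. by move=> a b; rewrite /quot_scale scalerDl rmorphD mulrDl. Qed.

HB.instance Definition _ := GRing.Zmodule_isLmodule.Build K Q
  quot_scaleA quot_scale1 quot_scaleDr quot_scaleDl.

Lemma quot_scaleAl (k : K) (x y : Q) : k *: (x * y) = (k *: x) * y.
Proof. exact: mulrA. Qed.

HB.instance Definition _ := GRing.Lmodule_isLalgebra.Build K Q quot_scaleAl.
HB.instance Definition _ := GRing.Lalgebra_isComAlgebra.Build K Q.

Lemma pi_scale (k : K) (a : A) : \pi_Q (k *: a) = k *: \pi_Q a.
Proof. by rewrite -[k *: a]mulr_algl rmorphM. Qed.

End QuotientAlgebra.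

Section Dimension.
Variables (K : fieldType) (V : lmodType K).

Definition is_basis (S : set V) d (e : 'I_d -> V) :=
  [/\ forall i, S (e i),
      forall c : 'I_d -> K, \sum_i c i *: e i = 0 -> forall i, c i = 0
    & forall v, S v -> exists c : 'I_d -> K, v = \sum_i c i *: e i].

(* Junk value 0 if [S] has no finite basis. *)
Definition subspace_dim (S : set V) : nat :=
  xget 0%N [set d | exists e : 'I_d -> V, is_basis S e].

Lemma basis_leq (S : set V) d d' (e : 'I_d -> V) (e' : 'I_d' -> V) :
  is_basis S e -> is_basis S e' -> (d <= d')%N.
Proof.
move=> [Se fe _] [Se' _ ge'].
pose S_coord i : {c : 'I_d' -> K | e i = \sum_j c j *: e' j} :=
  cid (ge' _ (Se i)).
pose M := \matrix_(i, j) sval (S_coord i) j.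
have eM i : e i = \sum_j M i j *: e' j.
  by rewrite [LHS](svalP (S_coord i)); apply: eq_bigr => j _; rewrite mxE.
rewrite -(eqP (_ : row_free M)) ?rank_leq_col // -kermx_eq0.
apply/eqP/row_matrixP => k; rewrite row0; apply/rowP => i; rewrite [RHS]mxE.
apply: (fe (row k (kermx M) 0)); under eq_bigr => l _ do rewrite eM scaler_sumr.
rewrite exchange_big big1 //= => j _.
under eq_bigr => l _ do rewrite scalerA.
rewrite -scaler_suml.
have /rowP/(_ j) : row k (kermx M) *m M = 0.
  by rewrite -row_mul mulmx_ker row0.
by rewrite !mxE => -> ; rewrite scale0r.
Qed.

Lemma subspace_dimE (S : set V) d (e : 'I_d -> V) :
  is_basis S e -> subspace_dim S = d.
Proof.
move=> be; rewrite /subspace_dim; case: xgetP => [d' _ [e' be']|].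
  by apply/eqP; rewrite eqn_leq (basis_leq be' be) (basis_leq be be').
by move=> /(_ d)[]; exists e.
Qed.

End Dimension.

Section FormalPowerSeries.
Variable K : fieldType.
Implicit Types f g : nat -> K.

Definition fps_of_poly (p : {poly K}) : nat -> K := fun d => p`_d.

Definition fps_mul f g : nat -> K := fun d => \sum_(i < d.+1) f i * g (d - i)%N.

(* First [d] coefficients of the inverse [g] of [f], solving
   [f 0 * g m + \sum_(i < m) f (m - i) * g i = (m == 0)] for [g m];
   meaningful when [f 0 != 0]. *)
Fixpoint fps_inv_seq f (d : nat) : seq K :=
  if d is m.+1 then
    let s := fps_inv_seq f m in
    rcons s ((f 0%N)^-1 * ((m == 0%N)%:R - \sum_(i < m) f (m - i)%N * s`_i))
  else [::].

Definition fps_inv f : nat -> K := fun d => (fps_inv_seq f d.+1)`_d.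

Definition fps_div f g : nat -> K := fps_mul f (fps_inv g).

Lemma size_fps_inv_seq f d : size (fps_inv_seq f d) = d.
Proof. by elim: d => //= d IHd; rewrite size_rcons IHd. Qed.

Lemma nth_fps_inv_seq f d i : (i < d)%N -> (fps_inv_seq f d)`_i = fps_inv f i.
Proof.
elim: d => // d IHd; rewrite ltnS leq_eqVlt => /orP[/eqP->//|id].
by rewrite /= nth_rcons size_fps_inv_seq id IHd.
Qed.

Lemma fps_mulV f : f 0%N != 0 ->
  fps_mul (fps_inv f) f =1 fps_of_poly 1.
Proof.
move=> f0 d; rewrite /fps_mul big_ord_recr /= subnn.
rewrite {2}/fps_inv /= nth_rcons size_fps_inv_seq ltnn eqxx.
rewrite mulrAC mulVf // mul1r /fps_of_poly coef1 addrC.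
under [X in _ - X + _]eq_bigr => i _ do rewrite nth_fps_inv_seq // mulrC.
by rewrite subrK.
Qed.

End FormalPowerSeries.

(* The positions [(i, j)] with [1 <= j <= i <= n + 1]. *)
Definition tri (n : nat) := {p : 'I_n.+2 * 'I_n.+2 | (0 < p.2 <= p.1)%N}.

Definition tri_array (n : nat) := {ffun tri n -> int}.

(* The entry [h_{ij}], with the 1-based indices of the informal definition;
   0 when [(i, j)] is not a position of the array. *)
Definition entry n (h : tri_array n) (i j : nat) : int :=
  oapp h 0 (insub (inord i, inord j)).

Definition boundary_a n (h : tri_array n) (i : nat) : int :=
  entry h i.+1 i.+1 - entry h i i.
Definition boundary_b n (h : tri_array n) (i : nat) : int :=
  entry h i.+1 1 - entry h i 1.
Definition boundary_c n (h : tri_array n) (i : nat) : int :=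
  entry h n.+1 i.+1 - entry h n.+1 i.

(* [s 1 >= s 2 >= ... >= s n >= 0] *)
Definition nonneg_dominant (n : nat) (s : nat -> int) : Prop :=
  (forall i, (1 <= i < n)%N -> s i.+1 <= s i) /\ 0 <= s n.

Definition rhombus_conditions n (h : tri_array n) : Prop :=
  [/\ forall i j, (1 <= j < i)%N -> (i <= n)%N ->
        entry h i j + entry h i.+1 j.+1 >= entry h i.+1 j + entry h i j.+1,
      forall i j, (1 <= j < i)%N -> (i <= n)%N ->
        entry h i j + entry h i j.+1 >= entry h i.+1 j.+1 + entry h i.-1 j
    & forall i j, (1 < j <= i)%N -> (i <= n)%N ->
        entry h i.+1 j + entry h i j >= entry h i.+1 j.+1 + entry h i j.-1].

Definition is_hive n (h : tri_array n) : Prop :=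
  [/\ entry h 1 1 = 0,
      rhombus_conditions h,
      nonneg_dominant n (boundary_a h),
      nonneg_dominant n (boundary_b h)
    & nonneg_dominant n (boundary_c h)].

Lemma entry_val n (h : tri_array n) (k : tri n) :
  h k = entry h (val k).1 (val k).2.
Proof.
by rewrite /entry !inord_val -surjective_pairing valK.
Qed.

Lemma nonneg_dominant_ge0 n s i :
  nonneg_dominant n s -> (1 <= i <= n)%N -> 0 <= s i.
Proof.
move=> [sS sn] /andP[i1 i_n]; rewrite -(subnKC i_n) in sS sn.
elim: (n - i)%N sS sn => [|d IHd] sS sn; first by rewrite addn0 in sn.
apply: IHd => [j /andP[j1 jd]|]; first by apply: sS; lia.
apply: le_trans sn _; rewrite addnS; apply: sS; lia.
Qed.

(* Hence the exponents [`|h_{ij}|] below are the [h_{ij}] themselves. *)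
Lemma hive_ge0 n (h : tri_array n) k : is_hive h -> 0 <= h k.
Proof.
move=> [h11 [hi _ hiii] _ hb hc]; rewrite entry_val.
case: k => -[[i ltin] [j ltjn]] /= /andP[j_gt0 leji].
have hcol m : (1 <= m <= n.+1)%N -> 0 <= entry h m 1.
  case: m => // m /= ltm; elim: m ltm => [|m IHm] ltm; first by rewrite h11.
  have := IHm (ltnW ltm).
  have : 0 <= boundary_b h m.+1 by apply: (nonneg_dominant_ge0 hb); lia.
  by rewrite /boundary_b; lia.
have hrow d m p : (m + d = n.+1)%N -> (1 <= p < m)%N ->
    0 <= entry h m p.+1 - entry h m p.
  elim: d m p => [|d IHd] m p md pm.
    have -> : m = n.+1 by lia.
    by apply: (@nonneg_dominant_ge0 n (boundary_c h) p hc); lia.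
  have IH : 0 <= entry h m.+1 p.+2 - entry h m.+1 p.+1 by apply: IHd; lia.
  have := hiii m p.+1 ltac:(lia) ltac:(lia); rewrite /=; lia.
elim: j j_gt0 leji {ltjn} => // -[_ _ leji|j IHj _ leji]; first by apply: hcol; lia.
have hij := IHj isT (ltnW leji).
have : 0 <= entry h i j.+2 - entry h i j.+1 by apply: (hrow (n.+1 - i)%N); lia.
lia.
Qed.

Section HiveAlgebra.
Variables (n : nat) (K : fieldType).

(* [K[z_{ij} : 1 <= j <= i <= n + 1]], the variable [z_k] for [k : tri n] being
   ['X_(enum_rank k)]. *)
Definition z_poly := {mpoly K[#|{: tri n}|]}.

Definition hive_mnm (h : tri_array n) : 'X_{1..#|{: tri n}|} :=
  [multinom `|h (enum_val k)|%N | k < #|{: tri n}|].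

Definition hive_monomials : set z_poly :=
  [set p | exists2 h : tri_array n, is_hive h & p = 'X_[hive_mnm h]].

Definition hive_algebra := gen_subalg hive_monomials.

HB.instance Definition _ := GRing.ComAlgebra.on hive_algebra.

Fact corner_subproof : (0 < (ord_max : 'I_n.+2) <= (ord_max : 'I_n.+2))%N.
Proof. by rewrite /= leqnn. Qed.

Definition corner : tri n := Sub (ord_max, ord_max) corner_subproof.

(* Homogeneous elements of degree [d] in [z_{n+1,n+1}] (including 0). *)
Definition hive_component (d : nat) : set hive_algebra :=
  [set p | forall m, m \in msupp (val p : z_poly) -> m (enum_rank corner) = d].

Definition hilbert_poincare : nat -> rat :=
  fun d => (subspace_dim (hive_component d))%:R.

End HiveAlgebra.

Section HiveRelation.
Variable K : fieldType.

(* 1-based numbering of the ten indeterminates. *)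
Definition x_ (i : nat) : {mpoly K[10]} := 'X_(inord i.-1).

Definition hive3_ideal : {pred {mpoly K[10]}} :=
  ideal_gen (x_ 1 * x_ 6 * x_ 7 - x_ 5 * x_ 10).

Lemma hive3_ideal_closed : idealr_closed hive3_ideal.
Proof.
apply: ideal_gen_closed; apply/negP => /ideal_genP[q].
move/(congr1 (meval (fun=> 0))); rewrite mevalM mevalB !mevalM !mevalXU meval1.
by rewrite !mulr0 subrr mulr0 => /eqP; rewrite oner_eq0.
Qed.

HB.instance Definition _ := isIdealr.Build _ hive3_ideal hive3_ideal_closed.

End HiveRelation.

Arguments hive3_ideal K _ : clear implicits.

(* Main.v *)
Require Import Defs.
From HB Require Import structures.
From mathcomp Require Import all_boot all_order all_algebra.
From mathcomp Require Import ring zify.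

(** The monoid of hives for GL(3) is generated by ten hives g_1, ..., g_10,
    whose corner entries w_k are 1, 1, 2, 3, 2, 2, 3, 3, 3, 4, subject to the
    single relation g_1 + g_6 + g_7 = g_5 + g_10.  Call an exponent vector m in
    N^10 reduced when m_5 = 0 or m_10 = 0.  Every hive is sum_k m_k g_k for
    exactly one reduced m: the nine generators other than g_10 form a basis of
    the lattice of arrays with h_11 = 0, so that h has integer coordinates in
    that basis; when the fifth coordinate d is negative, the relation trades
    d g_5 for d (g_1 + g_6 + g_7) - d g_10.  The resulting coordinates are
    nonnegative by the rhombus and dominance inequalities ([hive_coord_ge0]),
    so that [hive_of] and [hive_exp] are inverse bijections between reduced
    vectors and hives ([hive_ofK], [hive_expK]).

    Let phi send x_k to the monomial of g_k.  Its image is the hive algebra.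
    Using the relation, every polynomial is congruent modulo
    x_1 x_6 x_7 - x_5 x_10 to one supported on reduced monomials
    ([poly_reduce]), and phi maps distinct reduced monomials to distinct
    monomials; hence the kernel of phi is the ideal generated by the relation
    ([hive_map_ker]), which gives the presentation.

    It also follows that the component of degree d has for basis the images of
    the reduced monomials of weighted degree d ([hive_component_basis]).  The
    exponent vectors of length 10 and weighted degree d are counted by the
    series B = 1 / prod_k (1 - t^w_k), as one sees by peeling off one variable
    at a time ([fps_mul_wcomps]).  A vector that is not reduced is the sum of
    an arbitrary one and of the exponent of x_5 x_10, of degree 6, so that the
    reduced ones are counted by (1 - t^6) B ([fps_mul_reduced_wcomps]). *)

Set Implicit Arguments.
Unset Strict Implicit.
Unset Printing Implicit Defensive.

Import Order.TTheory GRing.Theory Num.Theory.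
Local Open Scope ring_scope.

(** * Formal power series *)

Section PowerSeries.
Variable K : fieldType.
Implicit Types f g h : nat -> K.

(** The coefficients of a product up to [D] are those of the product of the
    truncations, which transports the ring laws from polynomials. *)
Lemma fps_mul_coef f g d D : (d <= D)%N ->
  fps_mul f g d = ((\poly_(i < D.+1) f i) * (\poly_(i < D.+1) g i))`_d.
Proof.
move=> dD; rewrite coefM; apply: eq_bigr => i _; rewrite !coef_poly.
by rewrite !ifT //; move: (ltn_ord i); lia.
Qed.

Lemma fps_mulC f g : fps_mul f g =1 fps_mul g f.
Proof. by move=> d; rewrite !(fps_mul_coef _ _ (leqnn d)) mulrC. Qed.

Lemma eq_fps_mul f f' g g' : f =1 f' -> g =1 g' -> fps_mul f g =1 fps_mul f' g'.
Proof. by move=> ff gg d; apply: eq_bigr => i _; rewrite ff gg. Qed.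

Lemma fps_mulA f g h : fps_mul f (fps_mul g h) =1 fps_mul (fps_mul f g) h.
Proof.
move=> d; set P := fun u : nat -> K => \poly_(i < d.+1) u i.
transitivity ((P f * P g * P h)`_d).
  rewrite -mulrA coefM; apply: eq_bigr => i _.
  by rewrite (fps_mul_coef _ _ (leq_subr i d)) coef_poly ltn_ord.
rewrite coefM; apply: eq_bigr => i _.
have id : (i <= d)%N by rewrite -ltnS.
by rewrite (fps_mul_coef _ _ id) coef_poly ltnS leq_subr.
Qed.

Lemma fps_mul1 f : fps_mul f (fps_of_poly 1) =1 f.
Proof.
move=> d; rewrite /fps_mul big_ord_recr /= subnn /fps_of_poly coef1 mulr1.
rewrite big1 ?add0r // => i _; rewrite coef1.
by case: eqP (ltn_ord i) => [|_ _]; [lia|rewrite mulr0].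
Qed.

Lemma fps_of_polyM p q :
  fps_of_poly (p * q) =1 fps_mul (fps_of_poly p) (fps_of_poly q) :> (nat -> K).
Proof. by move=> d; rewrite /fps_of_poly coefM. Qed.

Lemma fps_divE f g a : g 0%N != 0 -> fps_mul a g =1 f -> a =1 fps_div f g.
Proof.
move=> g0 agf d; rewrite /fps_div -(eq_fps_mul agf (frefl _)) -fps_mulA.
rewrite -[LHS]fps_mul1; apply: eq_fps_mul => // e.
by rewrite fps_mulC fps_mulV.
Qed.

Lemma fps_mul_1subXn f w d :
  fps_mul f (fps_of_poly (1 - 'X^w)) d =
    f d - (if (w <= d)%N then f (d - w)%N else 0).
Proof.
transitivity (((\poly_(i < d.+1) f i) * (1 - 'X^w))`_d).
  by rewrite coefM; apply: eq_bigr => i _; rewrite coef_poly ltn_ord.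
rewrite mulrBr mulr1 coefB coefMXn !coef_poly ltnSn ltnNge.
by case: (leqP w d) => //= wd; rewrite ltnS leq_subr.
Qed.

End PowerSeries.

(** * Exponent sequences of a given weighted degree *)

(** The degree [\sum_i s_i * ws_i] of the exponent sequence [s] for the
    weights [ws]. *)
Fixpoint wdeg (ws s : seq nat) : nat :=
  match ws, s with
  | w :: ws', k :: s' => (k * w + wdeg ws' s')%N
  | _, _ => 0%N
  end.

(** For positive weights, the list without repetition of the exponent sequences
    of length [size ws] and weighted degree [d].  Being explicit, it allows
    their number to be computed. *)
Fixpoint wcomps (ws : seq nat) (d : nat) : seq (seq nat) :=
  if ws is w :: ws' then
    [seq k :: s | k <- [seq k <- iota 0 d.+1 | k * w <= d]%N,
                  s <- wcomps ws' (d - k * w)]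
  else if d is 0%N then [:: [::]] else [::].

Arguments wcomps : simpl never.

Lemma wcomps_cons w ws d :
  wcomps (w :: ws) d =
    [seq k :: s | k <- [seq k <- iota 0 d.+1 | k * w <= d]%N,
                  s <- wcomps ws (d - k * w)].
Proof. by []. Qed.

Lemma mem_wcomps ws d s : all (leq 1) ws ->
  (s \in wcomps ws d) = (size s == size ws) && (wdeg ws s == d).
Proof.
elim: ws d s => [|w ws IH] d s; first by case: d s => [|d] [|k s].
move=> /andP[w0 ws0]; apply/idP/idP => [|].
  rewrite wcomps_cons => /allpairsPdep -[k [t []]].
  rewrite mem_filter IH // => /andP[kd _] /andP[/eqP sz /eqP dt] ->.
  by rewrite /= sz dt eqxx /= subnKC.
case: s => [|k s] //=; rewrite eqSS => /andP[sz /eqP ds].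
rewrite wcomps_cons; apply/allpairsPdep; exists k, s.
rewrite mem_filter mem_iota IH // sz; split=> //.
  by rewrite -ds leq_addr /= add0n ltnS -[k in (k <= _)%N]muln1; nia.
by rewrite -ds addKn eqxx.
Qed.

Lemma wcomps_uniq ws d : uniq (wcomps ws d).
Proof.
elim: ws d => [|w ws IH] d; first by case: d.
rewrite wcomps_cons; apply: allpairs_uniq_dep => [|k _|].
- exact/filter_uniq/iota_uniq.
- exact: IH.
- by move=> [k s] [l t] _ _ [-> ->].
Qed.

(** Either the first exponent vanishes, or it can be decreased by 1. *)
Lemma size_wcomps_cons w ws d : all (leq 1) (w :: ws) ->
  size (wcomps (w :: ws) d) =
    (size (wcomps ws d)
     + if w <= d then size (wcomps (w :: ws) (d - w)) else 0)%N.
Proof.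
move=> /[dup] ww0 /andP[w0 ws0].
pose bump_head (s : seq nat) := (head 0%N s).+1 :: behead s.
pose t := if (w <= d)%N then map bump_head (wcomps (w :: ws) (d - w)) else [::].
transitivity (size (map (cons 0%N) (wcomps ws d) ++ t)); last first.
  by rewrite size_cat size_map /t; case: ifP => _; rewrite ?size_map.
have bump_inj : {in wcomps (w :: ws) (d - w) &, injective bump_head}.
  by move=> [|k s] [|l u]; rewrite !mem_wcomps //= => _ _ [-> ->].
have utl : uniq t.
  by rewrite /t; case: ifP => // _; rewrite map_inj_in_uniq ?wcomps_uniq.
apply/perm_size/uniq_perm; first exact: wcomps_uniq.
  rewrite cat_uniq utl map_inj_uniq ?wcomps_uniq ?andbT //=;
    last by move=> ? ? [].
  apply/hasPn => s; rewrite /t; case: ifP => // _ /mapP[u _ ->].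
  by apply/mapP => -[].
move=> s; rewrite mem_wcomps // mem_cat.
apply/idP/orP => [|[/mapP[u + ->]|]].
- case: s => [|[|k] s] //= /andP[/eqP[sz] /eqP ds].
    by left; apply: map_f; rewrite mem_wcomps // sz -ds mul0n add0n !eqxx.
  have wd : (w <= d)%N by lia.
  right; rewrite /t wd; apply/mapP; exists (k :: s) => //.
  by rewrite mem_wcomps //= sz eqxx /=; lia.
- by rewrite mem_wcomps //= mul0n add0n eqSS.
- rewrite /t; case: ifP => // wd /mapP[u + ->].
  rewrite mem_wcomps //; case: u => [|k u] //= /andP[-> /=]; lia.
Qed.

(** The generating series of the number of exponent sequences is the inverse
    of [\prod_w (1 - t^w)]. *)
Lemma fps_mul_wcomps (K : fieldType) ws : all (leq 1) ws ->
  fps_mul (fun d => (size (wcomps ws d))%:R)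
          (fps_of_poly (\prod_(w <- ws) (1 - 'X^w))) =1
  fps_of_poly (1 : {poly K}).
Proof.
elim: ws => [_ d|w ws IH ww0 d].
  by rewrite big_nil fps_mul1 /fps_of_poly coef1; case: d.
have ws0 : all (leq 1) ws by case/andP: ww0.
rewrite -[RHS](IH ws0) big_cons.
rewrite (eq_fps_mul (frefl _) (fps_of_polyM _ _)) fps_mulA.
apply: eq_fps_mul => // e; rewrite fps_mul_1subXn size_wcomps_cons // natrD.
by case: ifP => _; ring.
Qed.

Lemma wdeg_incr_nth ws s i : size s = size ws -> (i < size ws)%N ->
  wdeg ws (incr_nth s i) = (wdeg ws s + nth 0 ws i)%N.
Proof.
elim: ws s i => [|w ws IH] [|k s] [|i] //= [sz] i_lt.
  by rewrite mulSn; lia.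
by rewrite IH // addnA.
Qed.

Lemma incr_nth_pred s i : (0 < nth 0 s i)%N ->
  exists2 t, size t = size s & s = incr_nth t i.
Proof.
elim: s i => [|k s IH] [|i] //= hi.
  by exists (k.-1 :: s) => //=; rewrite prednK.
by have [t sz E] := IH _ hi; exists (k :: t); rewrite /= -?E ?sz.
Qed.

Lemma incr_nth_inj i s t :
  size s = size t -> incr_nth s i = incr_nth t i -> s = t.
Proof.
move=> sz eq_st; apply: (eq_from_nth (x0 := 0%N)) => // j _.
by have := congr1 (fun u => nth 0%N u j) eq_st; rewrite !nth_incr_nth => /addnI.
Qed.

(** On the sequences whose exponents at [i] and [j] are both positive,
    decreasing these by 1 is a bijection onto the sequences of degree
    [d - w]. *)
Lemma size_wcomps_pos ws i j d : all (leq 1) ws ->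
  (i < size ws)%N -> (j < size ws)%N -> i != j ->
  let w := (nth 0 ws i + nth 0 ws j)%N in
  size [seq s <- wcomps ws d | (0 < nth 0 s i)%N && (0 < nth 0 s j)%N] =
    if (w <= d)%N then size (wcomps ws (d - w)) else 0%N.
Proof.
move=> ws0 i_lt j_lt ij w.
pose incr2 s := incr_nth (incr_nth s i) j.
pose t := if (w <= d)%N then map incr2 (wcomps ws (d - w)) else [::].
transitivity (size t); last by rewrite /t; case: ifP => _; rewrite ?size_map.
have incr2_inj : {in wcomps ws (d - w) &, injective incr2}.
  move=> s u; rewrite !mem_wcomps // => /andP[/eqP ss _] /andP[/eqP su _].
  move=> E; apply: (@incr_nth_inj i); first by rewrite ss su.
  by apply: (@incr_nth_inj j); rewrite // !size_incr_nth ss su.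
apply/perm_size/uniq_perm; first exact/filter_uniq/wcomps_uniq.
  by rewrite /t; case: ifP => // _; rewrite map_inj_in_uniq ?wcomps_uniq.
move=> s; rewrite mem_filter mem_wcomps //.
apply/idP/idP => [/andP[/andP[si sj] /andP[/eqP sz /eqP ds]]|].
  have [s1 sz1 def_s] := incr_nth_pred sj.
  have s1i : (0 < nth 0 s1 i)%N.
    by move: si; rewrite def_s nth_incr_nth eq_sym (negPf ij).
  have [s2 sz2 def_s1] := incr_nth_pred s1i.
  have sz2' : size s2 = size ws by rewrite sz2 sz1.
  have E : wdeg ws s = (wdeg ws s2 + w)%N.
    by rewrite def_s wdeg_incr_nth ?sz1 // def_s1 wdeg_incr_nth // addnA.
  rewrite /t -ds E leq_addl addnK; apply/mapP; exists s2.
    by rewrite mem_wcomps // sz2' !eqxx.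
  by rewrite /incr2 -def_s1.
rewrite /t; case: ifP => // wd /mapP[u + ->].
rewrite mem_wcomps // => /andP[/eqP sz /eqP du]; rewrite /incr2.
rewrite !nth_incr_nth !size_incr_nth sz i_lt j_lt !eqxx /=.
rewrite !wdeg_incr_nth ?size_incr_nth ?sz ?i_lt // du -addnA subnK //.
by rewrite eqxx andbT; lia.
Qed.

Lemma fps_mul_reduced_wcomps (K : fieldType) ws i j : all (leq 1) ws ->
  (i < size ws)%N -> (j < size ws)%N -> i != j ->
  fps_mul
    (fun d => (size [seq s <- wcomps ws d
                    | (nth 0 s i == 0)%N || (nth 0 s j == 0)%N])%:R)
    (fps_of_poly (\prod_(w <- ws) (1 - 'X^w))) =1
  fps_of_poly (1 - 'X^(nth 0 ws i + nth 0 ws j) : {poly K}).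
Proof.
move=> ws0 i_lt j_lt ij d.
set w := (nth 0 ws i + nth 0 ws j)%N.
pose B e : K := (size (wcomps ws e))%:R.
rewrite -[RHS]fps_mul1 -(eq_fps_mul (frefl _) (fps_mul_wcomps K ws0)) fps_mulA.
apply: eq_fps_mul => // e; rewrite fps_mulC fps_mul_1subXn.
have -> : (if (w <= e)%N then B (e - w)%N else 0) =
    (size [seq s <- wcomps ws e | (0 < nth 0 s i)%N && (0 < nth 0 s j)%N])%:R.
  by rewrite size_wcomps_pos // -/w /B; case: ifP.
apply/esym/eqP; rewrite subr_eq -natrD /B -(count_predC (fun s =>
  (nth 0 s i == 0)%N || (nth 0 s j == 0)%N) (wcomps ws e)) !size_filter.
apply/eqP; congr (_ + _)%N%:R; apply: eq_count => s /=.
by rewrite negb_or !lt0n.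
Qed.

(** * Hives for GL(3) *)

(** The ten generators of the monoid of hives, row by row; [x_k] corresponds
    to the array at position [k - 1]. *)
Definition gens3 : seq (seq (seq nat)) :=
  [:: [:: [:: 0]; [:: 0; 1]; [:: 0; 1; 1]; [:: 0; 1; 1; 1]];
      [:: [:: 0]; [:: 1; 1]; [:: 1; 1; 1]; [:: 1; 1; 1; 1]];
      [:: [:: 0]; [:: 0; 1]; [:: 0; 1; 2]; [:: 0; 1; 2; 2]];
      [:: [:: 0]; [:: 0; 1]; [:: 0; 1; 2]; [:: 0; 1; 2; 3]];
      [:: [:: 0]; [:: 1; 1]; [:: 1; 2; 2]; [:: 1; 2; 2; 2]];
      [:: [:: 0]; [:: 1; 1]; [:: 2; 2; 2]; [:: 2; 2; 2; 2]];
      [:: [:: 0]; [:: 1; 1]; [:: 1; 2; 2]; [:: 1; 2; 3; 3]];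
      [:: [:: 0]; [:: 1; 1]; [:: 2; 2; 2]; [:: 2; 3; 3; 3]];
      [:: [:: 0]; [:: 1; 1]; [:: 2; 2; 2]; [:: 3; 3; 3; 3]];
      [:: [:: 0]; [:: 1; 2]; [:: 2; 3; 3]; [:: 2; 3; 4; 4]]]%N.

(** The entry [(i, j)], 1-based, of the generator at position [k], 0-based. *)
Definition gen3 (k i j : nat) : nat :=
  nth 0%N (nth [::] (nth [::] gens3 k) i.-1) j.-1.

(** The hive [\sum_k m_k g_k]. *)
Definition hive_of (m : 'X_{1..10}) : tri_array 3 :=
  [ffun p : tri 3 => (\sum_(k < 10) m k * gen3 k (val p).1 (val p).2)%N%:Z].

Lemma entry_hive_of m i j : (0 < j <= i)%N -> (i <= 4)%N ->
  entry (hive_of m) i j = (\sum_(k < 10) m k * gen3 k i j)%N%:Z.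
Proof.
move=> ji i4; rewrite /entry.
have i_ltn : (i < 5)%N by lia.
have j_ltn : (j < 5)%N by lia.
case: insubP => [p _ vp|]; last by rewrite /= !inordK // ji.
by rewrite /= ffunE vp /= !inordK.
Qed.

Lemma entry_hive_ofE m i j : (0 < j <= i)%N -> (i <= 4)%N ->
  entry (hive_of m) i j =
    (m (inord 0) * gen3 0 i j + m (inord 1) * gen3 1 i j
     + m (inord 2) * gen3 2 i j + m (inord 3) * gen3 3 i j
     + m (inord 4) * gen3 4 i j + m (inord 5) * gen3 5 i j
     + m (inord 6) * gen3 6 i j + m (inord 7) * gen3 7 i j
     + m (inord 8) * gen3 8 i j + m (inord 9) * gen3 9 i j)%N%:Z.
Proof.
move=> ji i4; rewrite entry_hive_of //.
under eq_bigr => k _ do rewrite -[in m k](inord_val k).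
by rewrite !big_ord_recr big_ord0 /= add0n.
Qed.

Lemma hive_of_hive m : is_hive (hive_of m).
Proof.
have E := entry_hive_ofE m.
split; rewrite /nonneg_dominant /boundary_a /boundary_b /boundary_c.
- by rewrite E //= /gen3 /=; lia.
- split=> i j ij i3;
    case: i ij i3 => [|[|[|[|i]]]] ij i3; try lia;
    case: j ij => [|[|[|[|j]]]] ij; try lia;
    by rewrite /= !E //= /gen3 /=; lia.
- split=> [i i3|]; last by rewrite !E //= /gen3 /=; lia.
  by case: i i3 => [|[|[|i]]] i3; try lia; rewrite !E //= /gen3 /=; lia.
- split=> [i i3|]; last by rewrite !E //= /gen3 /=; lia.
  by case: i i3 => [|[|[|i]]] i3; try lia; rewrite !E //= /gen3 /=; lia.
- split=> [i i3|]; last by rewrite !E //= /gen3 /=; lia.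
  by case: i i3 => [|[|[|i]]] i3; try lia; rewrite !E //= /gen3 /=; lia.
Qed.

(** The coordinate of a hive along [g_5] in the basis of the nine generators
    other than [g_10]. *)
Definition hive_gap (h : tri_array 3) : int :=
  entry h 2 1 - entry h 2 2 - entry h 3 1 + entry h 3 3
  + entry h 4 2 - entry h 4 3.

(** The coordinates of a hive along the ten generators, normalized so that
    those along [g_5] and [g_10] are the positive and negative parts of the
    gap; a negative gap is moved to [g_1], [g_6] and [g_7]. *)
Definition hive_coord (h : tri_array 3) : seq int :=
  let d := hive_gap h in
  [:: entry h 2 2 - entry h 2 1 + entry h 3 2 - entry h 3 3 + Num.min 0 d;
      entry h 2 1 + entry h 2 2 - entry h 3 2;
      entry h 3 3 - entry h 3 2 + entry h 4 3 - entry h 4 4;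
      entry h 4 4 - entry h 4 3;
      Num.max 0 d;
      entry h 3 1 - entry h 2 1 + entry h 3 2 - entry h 4 2 + Num.min 0 d;
      entry h 3 2 - entry h 3 3 - entry h 4 2 + entry h 4 3 + Num.min 0 d;
      entry h 3 1 - entry h 3 2 - entry h 4 1 + entry h 4 2;
      entry h 4 1 - entry h 3 1;
      Num.max 0 (- d)].

(** The absolute values are harmless on hives, by [hive_coord_ge0]. *)
Definition hive_exp (h : tri_array 3) : 'X_{1..10} :=
  [multinom `|(nth 0 (hive_coord h) k)%R|%N | k < 10].

(** Exponent vectors of monomials not divisible by [x_5 * x_10]. *)
Definition reduced (m : 'X_{1..10}) : bool :=
  (m (inord 4) == 0%N) || (m (inord 9) == 0%N).

Lemma reduced_hive_exp h : reduced (hive_exp h).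
Proof.
rewrite /reduced !mnmE !inordK //=.
by case: (lerP 0 (hive_gap h)) => d0; apply/orP; [right|left]; lia.
Qed.

(** On a reduced vector, the exponents of [x_5] and [x_10] are thus the positive
    and negative parts of the gap. *)
Lemma hive_gap_hive_of m :
  hive_gap (hive_of m) = (m (inord 4))%:Z - (m (inord 9))%:Z.
Proof. by rewrite /hive_gap !entry_hive_ofE // /gen3 /=; lia. Qed.

Lemma hive_ofK m : reduced m -> hive_exp (hive_of m) = m.
Proof.
rewrite /reduced => rm; apply/mnmP => k; rewrite mnmE -[in RHS](inord_val k).
rewrite /hive_coord hive_gap_hive_of.
case: k => [[|[|[|[|[|[|[|[|[|[|k]]]]]]]]]] kn]; last (by []);
  rewrite /nth /nat_of_ord; clear kn; rewrite ?entry_hive_ofE // /gen3.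
all: move: (m (inord 0)) (m (inord 1)) (m (inord 2)) (m (inord 3)) (m (inord 4))
  (m (inord 5)) (m (inord 6)) (m (inord 7)) (m (inord 8)) (m (inord 9)) rm.
all: move=> x0 x1 x2 x3 x4 x5 x6 x7 x8 x9 rm.
all: rewrite /=; lia.
Qed.

Lemma hive_coord_ge0 h k : is_hive h -> 0 <= nth 0 (hive_coord h) k.
Proof.
move=> [h11 [r1 r2 r3] [a a3] [b b3] [c c3]].
have A1 := r1 2%N 1%N isT isT; have A2 := r1 3%N 1%N isT isT.
have A3 := r1 3%N 2%N isT isT; have B1 := r2 2%N 1%N isT isT.
have B2 := r2 3%N 1%N isT isT; have B3 := r2 3%N 2%N isT isT.
have C1 := r3 2%N 2%N isT isT; have C2 := r3 3%N 2%N isT isT.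
have C3 := r3 3%N 3%N isT isT; move: A1 A2 A3 B1 B2 B3 C1 C2 C3.
move: a3 b3 c3 (a 1%N isT) (a 2%N isT) (b 1%N isT) (b 2%N isT) (c 1%N isT)
  (c 2%N isT).
rewrite /boundary_a /boundary_b /boundary_c /= h11.
clear r1 r2 r3 a b c h11 => *.
rewrite /hive_coord; case: k => [|[|[|[|[|[|[|[|[|[|k]]]]]]]]]];
  rewrite /nth ?le_max ?lexx //; try (case: k => //).
all: try case: (lerP 0 (hive_gap h)); rewrite /hive_gap => *.
all: lia.
Qed.

Lemma hive_expK h : is_hive h -> hive_of (hive_exp h) = h.
Proof.
move=> hh; have E k : (k < 10)%N ->
    (hive_exp h (inord k))%:Z = nth 0 (hive_coord h) k.
  by move=> k10; rewrite mnmE inordK // gez0_abs // hive_coord_ge0.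
apply/ffunP => p; rewrite !entry_val.
case: p => -[[i ltin] [j ltjn]] /= ji.
rewrite entry_hive_ofE // !PoszD !PoszM !E // /hive_coord.
(* Only the truncations of the gap are non-linear: with [min 0 gap] abstracted
   to [d], the entries agree as linear forms. *)
have -> : Num.max 0 (hive_gap h) = hive_gap h - Num.min 0 (hive_gap h) by lia.
have -> : Num.max 0 (- hive_gap h) = - Num.min 0 (hive_gap h) by lia.
move: (Num.min 0 (hive_gap h)) => d; rewrite /hive_gap /gen3.
have [h11 _ _ _ _] := hh.
clear ltjn E hh.
case: i ltin ji => [|[|[|[|[|i]]]]] ltin ji; try lia;
  case: j ji => [|[|[|[|[|j]]]]] ji; try lia; clear ltin ji;
  rewrite /=; lia.
Qed.

(** * The presentation of the hive algebra *)

Lemma hive_mnm_inj n (h h' : tri_array n) :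
  is_hive h -> is_hive h' -> hive_mnm h = hive_mnm h' -> h = h'.
Proof.
move=> hh hh' /mnmP eq_h; apply/ffunP => p.
have /(congr1 Posz) := eq_h (enum_rank p).
by rewrite !mnmE enum_rankK !gez0_abs ?hive_ge0.
Qed.

(** The exponent, in the variables [z_ij], of the image of the monomial with
    exponent [m] in the variables [x_k]. *)
Definition hive_img (m : 'X_{1..10}) := hive_mnm (hive_of m).

Lemma hive_imgE m k :
  hive_img m k =
    (\sum_(i < 10) m i * gen3 i (val (enum_val k)).1 (val (enum_val k)).2)%N.
Proof. by rewrite mnmE ffunE absz_nat. Qed.

Lemma hive_imgD m1 m2 : hive_img (m1 + m2)%MM = (hive_img m1 + hive_img m2)%MM.
Proof.
apply/mnmP => k; rewrite mnmDE !hive_imgE -big_split /=.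
by apply: eq_bigr => i _; rewrite mnmDE mulnDl.
Qed.

Lemma hive_img0 : hive_img 0%MM = 0%MM.
Proof.
by apply/mnmP => k; rewrite hive_imgE mnm0E big1 // => i _; rewrite mnm0E.
Qed.

Lemma hive_imgMn m n : hive_img (m *+ n)%MM = (hive_img m *+ n)%MM.
Proof.
by elim: n => [|n IH]; rewrite ?mulm0n ?hive_img0 // !mulmS hive_imgD IH.
Qed.

Lemma hive_img_sum I (r : seq I) (F : I -> 'X_{1..10}) :
  hive_img (\sum_(i <- r) F i)%MM = (\sum_(i <- r) hive_img (F i))%MM.
Proof. exact: (big_morph _ hive_imgD hive_img0). Qed.

Lemma hive_img_inj : {in reduced &, injective hive_img}.
Proof.
move=> m m' rm rm' /(hive_mnm_inj (hive_of_hive m) (hive_of_hive m')) eq_m.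
by rewrite -(hive_ofK rm) eq_m hive_ofK.
Qed.

Lemma hive_img_onto h : is_hive h ->
  exists2 m, reduced m & hive_mnm h = hive_img m.
Proof.
move=> hh; exists (hive_exp h); first exact: reduced_hive_exp.
by rewrite /hive_img hive_expK.
Qed.

(** The exponents of [x_1 * x_6 * x_7] and [x_5 * x_10]. *)
Definition mon167 : 'X_{1..10} := (U_(inord 0) + U_(inord 5) + U_(inord 6))%MM.
Definition mon510 : 'X_{1..10} := (U_(inord 4) + U_(inord 9))%MM.

Lemma mnm1_inordE i j : (i < 10)%N -> (j < 10)%N ->
  (U_(inord i) : 'X_{1..10})%MM (inord j) = (i == j).
Proof. by move=> i10 j10; rewrite mnm1E -val_eqE /= !inordK. Qed.

Lemma hive_img_relation : hive_img mon167 = hive_img mon510.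
Proof.
congr hive_mnm; apply/ffunP => p; rewrite !entry_val.
case: p => -[[i ltin] [j ltjn]] /= ji.
rewrite !entry_hive_ofE // !mnmDE !mnm1_inordE //= /gen3.
case: i ltin ji => [|[|[|[|[|i]]]]] ltin ji; try lia;
  case: j ltjn ji => [|[|[|[|[|j]]]]] ltjn ji; try lia; by [].
Qed.

Section HiveMap.
Variable K : fieldType.

(** The images of the indeterminates under the algebra morphism from
    [K[x_1, ..., x_10]] onto the hive algebra, which is composition with this
    tuple. *)
Definition hive_gens := [tuple 'X_[hive_img U_(i)] : z_poly 3 K | i < 10].

Local Notation hive_map := (comp_mpoly hive_gens).
Local Notation rel := (x_ K 1 * x_ K 6 * x_ K 7 - x_ K 5 * x_ K 10).

Lemma hive_mapX m : hive_map 'X_[m] = 'X_[hive_img m].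
Proof.
rewrite comp_mpolyX; under eq_bigr do rewrite tnth_mktuple mpolyXn.
rewrite mprodXE [in RHS](multinomUE_id m) hive_img_sum.
by under [in RHS]eq_bigr do rewrite hive_imgMn.
Qed.

Lemma hive_mapE p : hive_map p = \sum_(m <- msupp p) p@_m *: 'X_[hive_img m].
Proof.
rewrite [in LHS](mpolyE p) linear_sum; apply: eq_bigr => m _.
by rewrite linearZ /= hive_mapX.
Qed.

Lemma relE : rel = 'X_[mon167] - 'X_[mon510].
Proof. by rewrite /x_ !mpolyXD. Qed.

Lemma hive_map_rel : hive_map rel = 0.
Proof. by rewrite relE raddfB /= !hive_mapX hive_img_relation subrr. Qed.

(** Polynomials none of whose monomials is divisible by [x_5 * x_10]. *)
Definition reduced_poly (q : {mpoly K[10]}) :=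
  forall m, m \in msupp q -> reduced m.

(** Replacing [x_5 * x_10] by [x_1 * x_6 * x_7] lowers the exponent of [x_5],
    so that the rewriting terminates. *)
Lemma monomial_reduce m :
  exists2 m', reduced m' & exists r, 'X_[m] = 'X_[m'] + r * rel.
Proof.
have [n] := ubnP (m (inord 4)); elim: n m => // n IH m mn.
have [rm|] := boolP (reduced m).
  by exists m => //; exists 0; rewrite mul0r addr0.
rewrite /reduced negb_or => /andP[m4 m9].
have le_m : (mon510 <= m)%MM.
  apply/mnm_lepP => k.
  rewrite mnmDE -[k in m k]inord_val !mnm1E -!val_eqE /= !inordK //.
  case: k => [[|[|[|[|[|[|[|[|[|[|k]]]]]]]]]] kn] //=; lia.
pose m1 := (m - mon510)%MM.
have def_m : m = (m1 + mon510)%MM by rewrite submK.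
have [|m' rm' [r Er]] := IH (m1 + mon167)%MM.
  move: mn; rewrite def_m !mnmDE !mnm1_inordE //=; lia.
exists m' => //; exists (r - 'X_[m1]).
rewrite def_m mulrBl addrA -Er relE !mpolyXD; ring.
Qed.

Lemma poly_reduce p :
  exists2 q, reduced_poly q & exists r, p = q + r * rel.
Proof.
elim/mpolyind: p => [|c m p _ _ [q rq [r ->]]].
  exists 0; last by exists 0; rewrite mul0r addr0.
  by move=> m; rewrite msupp0.
have [m' rm' [s ->]] := monomial_reduce m.
exists (c *: 'X_[m'] + q); last first.
  by exists (c *: s + r); rewrite -!mul_mpolyC; ring.
move=> k /msuppD_le; rewrite mem_cat => /orP[/msuppZ_le|/rq//].
by rewrite msuppX mem_seq1 => /eqP->.
Qed.

Lemma mcoeff_hive_map q m : reduced_poly q -> reduced m ->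
  (hive_map q)@_(hive_img m) = q@_m.
Proof.
move=> rq rm; rewrite hive_mapE raddf_sum [in RHS](mpolyE q) raddf_sum /=.
apply: eq_big_seq => m' /rq rm'; rewrite !mcoeffZ !mcoeffX.
by rewrite (inj_in_eq hive_img_inj).
Qed.

Lemma hive_map_inj_reduced q : reduced_poly q -> hive_map q = 0 -> q = 0.
Proof.
move=> rq q0; apply/mpolyP => m; rewrite mcoeff0.
have [/rq rm|] := boolP (m \in msupp q); last by move/memN_msupp_eq0.
by rewrite -mcoeff_hive_map // q0 mcoeff0.
Qed.

Lemma hive_map_ker p : (hive_map p == 0) = (p \in hive3_ideal K).
Proof.
apply/eqP/ideal_genP => [p0|[r ->]]; last first.
  by rewrite rmorphM /= hive_map_rel mulr0.
have [q rq [r def_p]] := poly_reduce p; exists r.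
move: p0; rewrite def_p rmorphD rmorphM /= hive_map_rel mulr0 addr0.
by move=> /(hive_map_inj_reduced rq) ->; rewrite add0r.
Qed.

Lemma alg_gen_hiveP a :
  reflect (exists2 q, reduced_poly q & a = hive_map q)
          (a \in alg_gen (hive_monomials (n:=3) (K:=K))).
Proof.
apply: (iffP idP) => [/alg_genP|[q _ ->]]; last first.
  rewrite hive_mapE rpred_sum // => m _; apply: rpredZ; apply: mem_alg_gen.
  by exists (hive_of m); [exact: hive_of_hive|].
have red p : exists2 q, reduced_poly q & hive_map p = hive_map q.
  have [q rq [r ->]] := poly_reduce p; exists q => //.
  by rewrite rmorphD rmorphM /= hive_map_rel mulr0 addr0.
(* The image of the morphism is a subalgebra containing the hive monomials. *)
move=> /(_ (fun a => `[< exists q, a = hive_map q >])) aS.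
suff /asboolP[p ->] : `[< exists q, a = hive_map q >] by exact: red.
apply: aS => [|g [h hh ->]]; last first.
  have [m _ ->] := hive_img_onto hh.
  by apply/asboolP; exists 'X_[m]; rewrite hive_mapX.
split.
- by apply/asboolP; exists 1; rewrite rmorph1.
- move=> c x y /asboolP[p ->] /asboolP[q ->]; apply/asboolP.
  by exists (c *: p + q); rewrite linearP.
- move=> x y /asboolP[p ->] /asboolP[q ->]; apply/asboolP.
  by exists (p * q); rewrite rmorphM.
Qed.

Local Notation HA := (hive_algebra 3 K).
Local Notation Q := {ideal_quot (hive3_ideal K)}.

Fact hive_lift_subproof (a : HA) :
  exists q, val a = hive_map q.
Proof. by have /alg_gen_hiveP[q _] := valP a; exists q. Qed.

(** A chosen preimage; its class modulo the relation does not depend on the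
    choice. *)
Definition hive_lift (a : HA) : {mpoly K[10]} :=
  sval (cid (hive_lift_subproof a)).

Lemma hive_liftK a : hive_map (hive_lift a) = val a.
Proof. by rewrite /hive_lift; case: cid. Qed.

(** The isomorphism from the hive algebra to the quotient: the class of any
    preimage. *)
Definition hive_iso (a : HA) : Q := \pi_Q%qT (hive_lift a).

Lemma pi_hive_eq p q : hive_map p = hive_map q -> \pi_Q%qT p = \pi_Q%qT q.
Proof.
move=> pq; apply/eqP; rewrite -Quotient.idealrBE -hive_map_ker raddfB /=.
by rewrite pq subrr.
Qed.

Lemma hive_isoE a p : hive_map p = val a -> hive_iso a = \pi_Q%qT p.
Proof. by move=> pa; apply: pi_hive_eq; rewrite hive_liftK. Qed.

Fact hive_iso_zmod_morphism : zmod_morphism hive_iso.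
Proof.
move=> a b; rewrite (@hive_isoE _ (hive_lift a - hive_lift b)) ?rmorphB //=.
by rewrite !hive_liftK.
Qed.

Fact hive_iso_monoid_morphism : monoid_morphism hive_iso.
Proof.
split; first by rewrite (@hive_isoE _ 1) ?rmorph1.
move=> a b; rewrite (@hive_isoE _ (hive_lift a * hive_lift b)) ?rmorphM //=.
by rewrite !hive_liftK.
Qed.

Fact hive_iso_scalable : scalable hive_iso.
Proof.
move=> c a; rewrite (@hive_isoE _ (c *: hive_lift a)).
  exact: pi_scale.
by rewrite linearZ /= hive_liftK.
Qed.

HB.instance Definition _ :=
  GRing.isZmodMorphism.Build HA Q hive_iso hive_iso_zmod_morphism.
HB.instance Definition _ :=
  GRing.isMonoidMorphism.Build HA Q hive_iso hive_iso_monoid_morphism.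
HB.instance Definition _ :=
  GRing.isScalable.Build K HA Q *:%R hive_iso hive_iso_scalable.

Lemma hive_iso_bij : bijective hive_iso.
Proof.
have surj x : exists a, hive_iso a = x.
  have [p ->] : exists p, x = \pi_Q%qT p by exists (repr x); rewrite reprK.
  have pP : hive_map p \in alg_gen (hive_monomials (n:=3) (K:=K)).
    have [q rq [r ->]] := poly_reduce p; apply/alg_gen_hiveP; exists q => //.
    by rewrite rmorphD rmorphM /= hive_map_rel mulr0 addr0.
  by exists (GenSubalg pP); apply: hive_isoE.
exists (fun x => sval (cid (surj x))) => [a|x]; last by case: cid.
case: cid => b /= /eqP; rewrite -Quotient.idealrBE -hive_map_ker raddfB /=.
by rewrite !hive_liftK subr_eq0 => /eqP/val_inj.
Qed.

End HiveMap.

(** * The Hilbert series *)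

(** The corner entries [g_k(4, 4)] of the generators, which are the degrees of
    their monomials. *)
Definition hive_weights : seq nat := [:: 1; 1; 2; 3; 2; 2; 3; 3; 3; 4]%N.

Lemma wdegE ws s : size s = size ws ->
  wdeg ws s = (\sum_(i < size ws) nth 0 s i * nth 0 ws i)%N.
Proof.
elim: ws s => [|w ws IH] [|k s] //= => [_|[sz]]; first by rewrite big_ord0.
by rewrite big_ord_recl /= IH.
Qed.

Lemma hive_img_corner m :
  hive_img m (enum_rank (corner 3)) = wdeg hive_weights m.
Proof.
rewrite hive_imgE enum_rankK wdegE ?size_tuple //; apply: eq_bigr => i _.
rewrite (mnm_nth 0%N); congr (_ * _)%N.
by case: i => [[|[|[|[|[|[|[|[|[|[|i]]]]]]]]]] ?].
Qed.

(** The reduced exponent vectors of degree [d], as sequences and then as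
    multinomials. *)
Definition reduced_comps d : seq (seq nat) :=
  [seq s <- wcomps hive_weights d | (nth 0 s 4 == 0)%N || (nth 0 s 9 == 0)%N].

Definition mnm_of_seq (s : seq nat) : 'X_{1..10} :=
  [multinom nth 0%N s i | i < 10].

Lemma mnm_of_seqK s : size s = 10%N -> mnm_of_seq s = s :> seq nat.
Proof.
move=> sz; apply: (eq_from_nth (x0 := 0%N)); first by rewrite sz size_tuple.
move=> i; rewrite size_tuple => i10.
by rewrite -(mnm_nth 0%N _ (Ordinal i10)) mnmE.
Qed.

Definition reduced_mnms d : seq 'X_{1..10} := map mnm_of_seq (reduced_comps d).

Lemma size_reduced_comp d s : s \in reduced_comps d -> size s = 10%N.
Proof. by rewrite mem_filter mem_wcomps // => /and3P[_ /eqP]. Qed.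

Lemma reduced_mnms_uniq d : uniq (reduced_mnms d).
Proof.
rewrite map_inj_in_uniq ?filter_uniq ?wcomps_uniq // => s t ss st eq_st.
rewrite -(mnm_of_seqK (size_reduced_comp ss)) eq_st mnm_of_seqK //.
exact: size_reduced_comp st.
Qed.

Lemma mem_reduced_mnms d m :
  (m \in reduced_mnms d) = reduced m && (wdeg hive_weights m == d).
Proof.
have rE k : reduced k = (nth 0 k 4 == 0)%N || (nth 0 k 9 == 0)%N.
  by rewrite /reduced !(mnm_nth 0%N) !inordK.
apply/mapP/idP => [[s ss ->]|/andP[rm dm]].
  rewrite rE mnm_of_seqK ?(size_reduced_comp ss) //.
  by move: ss; rewrite mem_filter mem_wcomps // => /and3P[-> _].
exists (m : seq nat); last by apply/mnmP => i; rewrite mnmE (mnm_nth 0%N).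
by rewrite mem_filter mem_wcomps // size_tuple dm -rE rm.
Qed.

Section HilbertSeries.
Variable K : fieldType.

Local Notation HA := (hive_algebra 3 K).

Fact hive_monomial_subproof m :
  'X_[hive_img m] \in alg_gen (hive_monomials (n:=3) (K:=K)).
Proof.
by apply: mem_alg_gen; exists (hive_of m) => //; apply: hive_of_hive.
Qed.

(** The image of the monomial with exponent [m], as an element of the hive
    algebra. *)
Definition hive_monomial m : HA := GenSubalg (hive_monomial_subproof m).

(** Stated for an arbitrary list [L] of the reduced exponents of degree [d]. *)
Lemma hive_component_basis d (L : seq 'X_{1..10}) : uniq L ->
    (forall m, (m \in L) = reduced m && (wdeg hive_weights m == d)) ->
  is_basis (@hive_component 3 K d)
    (fun i : 'I_(size L) => hive_monomial (nth 0%MM L i)).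
Proof.
move=> uL LP.
have mem_L (i : 'I_(size L)) : nth 0%MM L i \in L by rewrite mem_nth.
have valE (c : 'I_(size L) -> K) :
    val (\sum_i c i *: hive_monomial (nth 0%MM L i)) =
      \sum_i c i *: 'X_[hive_img (nth 0%MM L i)].
  by rewrite raddf_sum; apply: eq_bigr => i _.
split=> [i|c c0 i|v vd].
- move=> m.
  have -> : val (hive_monomial (nth 0%MM L i)) =
      'X_[hive_img (nth 0%MM L i)] by [].
  rewrite msuppX mem_seq1 => /eqP ->; rewrite hive_img_corner.
  by have := mem_L i; rewrite LP => /andP[_ /eqP].
- have := congr1 (mcoeff (hive_img (nth 0%MM L i)) \o val) c0.
  rewrite /= valE raddf_sum mcoeff0 /= (bigD1 i) //= big1 ?addr0 => [|j ji].
    by rewrite mcoeffZ mcoeffX eqxx mulr1.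
  rewrite mcoeffZ mcoeffX (inj_in_eq hive_img_inj).
  + by rewrite nth_uniq // val_eqE (negPf ji) mulr0.
  + by have := mem_L j; rewrite LP => /andP[].
  + by have := mem_L i; rewrite LP => /andP[].
have /alg_gen_hiveP[q rq vq] := valP v.
exists (fun i => q@_(nth 0%MM L i)); apply: val_inj; rewrite valE.
have -> : val v = \sum_(m <- L) q@_m *: 'X_[hive_img m]; last first.
  by rewrite (big_nth 0%MM) big_mkord.
rewrite {1}vq.
have {1}-> : q = \sum_(m <- L) q@_m *: 'X_[m].
  apply/mpolyP => k; rewrite raddf_sum /=.
  under eq_bigr => m _ do rewrite mcoeffZ mcoeffX.
  have [kL|kL] := boolP (k \in L).
    rewrite (bigD1_seq k) //= eqxx mulr1 big1 ?addr0 // => m mk.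
    by rewrite (negPf mk) mulr0.
  rewrite big_seq big1 => [|m mL]; last first.
    by case: eqP => [mk|]; rewrite ?mulr0 //; rewrite -mk mL in kL.
  (* A reduced monomial of [q] keeps its coefficient in [v], so its degree is
     [d]. *)
  apply: contraNeq kL; rewrite -mcoeff_msupp => kq.
  have rk := rq _ kq; rewrite LP rk andTb -hive_img_corner.
  by apply/eqP/vd; rewrite vq mcoeff_msupp mcoeff_hive_map // -mcoeff_msupp.
rewrite linear_sum; apply: eq_bigr => m _.
by rewrite linearZ /= hive_mapX.
Qed.

Lemma hilbert_poincareE d :
  hilbert_poincare 3 K d = (size (reduced_comps d))%:R.
Proof.
have basis := hive_component_basis (reduced_mnms_uniq d) (mem_reduced_mnms d).
by rewrite /hilbert_poincare (subspace_dimE basis) size_map.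
Qed.

Lemma hilbert_poincare_series :
  hilbert_poincare 3 K =1
     fps_div (fps_of_poly (1 - 'X^6))
             (fps_of_poly ((1 - 'X) ^+ 2 * (1 - 'X^2) ^+ 3
                           * (1 - 'X^3) ^+ 4 * (1 - 'X^4))).
Proof.
have prodE : \prod_(w <- hive_weights) (1 - 'X^w) =
    (1 - 'X) ^+ 2 * (1 - 'X^2) ^+ 3 * (1 - 'X^3) ^+ 4 * (1 - 'X^4)
    :> {poly rat}.
  by rewrite !big_cons big_nil; ring.
apply: fps_divE => [|d]; first by rewrite /fps_of_poly -horner_coef0 !hornerE.
(* The positions 4 and 9 of [x_5] and [x_10] have weights 2 + 4 = 6. *)
rewrite -prodE (eq_fps_mul hilbert_poincareE (frefl _)).
exact: (@fps_mul_reduced_wcomps _ hive_weights 4 9).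
Qed.

Lemma hilbert_poincare_values :
  [seq hilbert_poincare 3 K d | d <- iota 0 10] =
     [:: 1; 2; 6; 14; 29; 56; 105; 182; 308; 502].
Proof.
rewrite (eq_map hilbert_poincareE) (map_comp (fun k => k%:R)).
have -> : [seq size (reduced_comps d) | d <- iota 0 10] =
  [:: 1; 2; 6; 14; 29; 56; 105; 182; 308; 502]%N by vm_compute.
by [].
Qed.

End HilbertSeries.

Theorem theorem2p6 (R : realType) :
  (exists f : {lrmorphism hive_algebra 3 R[i] -> {ideal_quot (hive3_ideal R[i])}},
     bijective f)
  /\
  (hilbert_poincare 3 R[i] =
     fps_div (fps_of_poly (1 - 'X^6))
             (fps_of_poly ((1 - 'X) ^+ 2 * (1 - 'X^2) ^+ 3
                           * (1 - 'X^3) ^+ 4 * (1 - 'X^4)))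
   /\
   [seq hilbert_poincare 3 R[i] d | d <- iota 0 10] =
     [:: 1; 2; 6; 14; 29; 56; 105; 182; 308; 502]).
Proof.
split; first by exists (@hive_iso R[i]); exact: hive_iso_bij.
by split; [exact/funext/hilbert_poincare_series|exact: hilbert_poincare_values].
Qed.
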